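(* Let $N\in\mathbb N$, $n\in\{1,\dots,N-1\}$ and $a>-1/2$ be fixed, and consider the dual Hahn polynomial $W_n^{(\alpha)}$ with $-1<\alpha<2a+1$. If $a\ge 0$, the zeros of $W_n^{(\alpha)}$ are strictly increasing functions of $\alpha$ on $(-1,2a+1)$. If $-1/2<a<0$, the zeros of $W_n^{(\alpha)}$ are strictly increasing functions of $\alpha$ on $(a,2a+1)$.
   Context: The dual Hahn polynomial is the polynomial of degree $n$ in the variable $X=x(s)=s(s+1)$ given by $$W_n^{(\alpha)}(X)={}_3F_2\left(\left.{-n,\,a-s,\,s+a+1\atop \alpha+1,\,1-N}\right|1\right)=\sum_{k=0}^n\frac{(-n)_k(a-s)_k(s+a+1)_k}{(\alpha+1)_k(1-N)_k\,k!},$$ where $(u)_k=\prod_{j=1}^k(u+j-1)$. Zeros are zeros in the variable $X$; there are $n$ of them, real and distinct, lying in $(x(a),x(a+N-1))$. The statement refers to each zero (the zeros being arranged in increasing order) as a function of $\alpha$, with $a$ and $N$ fixed. *)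

(* Defs.v *)
From mathcomp Require Import all_boot all_order all_algebra.
From mathcomp Require Import reals polyrcf ring.
Set Implicit Arguments.
Unset Strict Implicit.
Unset Printing Implicit Defensive.
Import Order.TTheory GRing.Theory Num.Theory.
Local Open Scope ring_scope.

(* The rising factorial (u)_k. *)
Definition poch (R : realType) (u : R) (k : nat) : R :=
  \prod_(1 <= j < k.+1) (u + j%:R - 1).

Definition xlattice (R : realType) (s : R) : R := s * (s + 1).

(* The 3F2 sum as a polynomial in X = x(s) = s (s + 1), using
   (a - s + j) (s + a + 1 + j) = x(a + j) - x(s); see [dual_hahnE]. *)
Definition dual_hahn (R : realType) (N : nat) (a : R) (n : nat) (alpha : R)
    : {poly R} :=
  \sum_(k < n.+1)
    (poch (- n%:R) k / (poch (alpha + 1) k * poch (1 - N%:R) k * k`!%:R)) *: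
    \prod_(j < k) ((xlattice (a + j%:R))%:P - 'X).

Lemma dual_hahnE (R : realType) (N : nat) (a : R) (n : nat) (alpha s : R) :
  (dual_hahn N a n alpha).[xlattice s] =
  \sum_(k < n.+1)
    (poch (- n%:R) k * poch (a - s) k * poch (s + a + 1) k)
    / (poch (alpha + 1) k * poch (1 - N%:R) k * k`!%:R).
Proof.
rewrite /dual_hahn horner_sum; apply: eq_bigr => k _.
rewrite hornerZ horner_prod mulrAC; congr (_ * _).
rewrite -[RHS]mulrA; congr (_ * _).
rewrite /poch !big_add1 /= !big_mkord -big_split /=.
by apply: eq_bigr => j _; rewrite !hornerE /xlattice -natr1; ring.
Qed.

(* The i-th zero in increasing order, counting from 0 (and 0 by default when
   there are at most i real zeros, which cannot happen in the parameter range
   considered for i < n). *)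
Definition dual_hahn_zero (R : realType) (N : nat) (a : R) (n i : nat)
    (alpha : R) : R :=
  (rootsR (dual_hahn N a n alpha))`_i.

(* Main.v *)
(* Markov's theorem for discrete measures, by comparison rather than by
   differentiation.  The polynomial W_n^(alpha) is orthogonal, on the nodes
   x(a), ..., x(a+N-1), with respect to positive weights w_alpha, and
   w_beta / w_alpha increases along the nodes when alpha < beta.  Let z_j and
   y_j be the zeros of W_n^(alpha) and W_n^(beta), and consider
     r = prod_(j < i) (X - z_j) * prod_(j > i) (X - y_j),
   of degree n - 1.  Gauss quadrature at the z_j gives
   sum w_alpha (x - z_i) r^2 >= 0, quadrature at the y_j gives
   sum w_beta (x - y_i) r^2 <= 0, and Chebyshev's sum inequality turns the
   former into sum w_beta (x - z_i) r^2 > 0, so z_i < y_i. *)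

Require Import Defs.
From mathcomp Require Import all_boot all_order all_algebra.
From mathcomp Require Import reals polyrcf ring lra zify.
Set Implicit Arguments.
Unset Strict Implicit.
Unset Printing Implicit Defensive.
Import Order.TTheory GRing.Theory Num.Theory.
Local Open Scope ring_scope.

(** * Polynomials on a finite set of nodes *)

Lemma size_prod_XsubC_neq (R : idomainType) n (i : 'I_n) (c : 'I_n -> R) :
  size (\prod_(j | j != i) ('X - (c j)%:P)) = n.
Proof.
rewrite -big_filter size_prod_XsubC; have [e _ _ [_ ->]] := big_enumP.
by rewrite cardC1 card_ord prednK // (leq_ltn_trans _ (ltn_ord i)).
Qed.

Lemma poly_eq0_on_nodes (R : idomainType) N (x : nat -> R) (f : {poly R}) :
  {in [pred m | (m < N)%N] &, injective x} ->
  (size f <= N)%N -> (forall m, (m < N)%N -> f.[x m] = 0) -> f = 0.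
Proof.
move=> x_inj sf f0; apply: (@roots_geq_poly_eq0 _ f [seq x m | m <- iota 0 N]).
- by apply/allP=> _ /mapP[m + ->]; rewrite mem_iota rootE => /f0 ->.
- rewrite map_inj_in_uniq ?iota_uniq // => i j.
  by rewrite !mem_iota; apply: x_inj.
- by rewrite size_map size_iota.
Qed.

(** Once [f] is nonzero at [x i], the root bound still applies to [f * ('X - (x i)%:P)] and yields a
    second node. Two such nodes are what makes Chebyshev's inequality strict. *)
Lemma poly_two_nodes (R : idomainType) N (x : nat -> R) (f : {poly R}) :
  {in [pred m | (m < N)%N] &, injective x} -> f != 0 -> (size f < N)%N ->
  exists i j, (i < j < N)%N && (f.[x i] * f.[x j] != 0).
Proof.
move=> x_inj.
have ex (g : {poly R}) : g != 0 -> (size g <= N)%N ->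
    exists2 m, (m < N)%N & g.[x m] != 0.
  move=> g0 sg; have [[m mN] gm|] := pickP (fun m : 'I_N => g.[x m] != 0).
    by exists m.
  move=> H; case/eqP: g0; apply: (poly_eq0_on_nodes x_inj) => // m mN.
  by have /= := H (Ordinal mN) => /negbFE/eqP.
move=> f0 sf; have [i iN fi] := ex f f0 (ltnW sf).
have [||j jN] := ex (f * ('X - (x i)%:P)).
- by rewrite mulf_neq0 // polyXsubC_eq0.
- by rewrite size_Mmonic ?monicXsubC // size_XsubC addn2.
rewrite hornerM mulf_eq0 negb_or hornerXsubC subr_eq0 => /andP[fj].
have [->|] := eqVneq i j; first by rewrite eqxx.
rewrite neq_ltn => /orP[] lij _; [exists i, j|exists j, i].
  by rewrite lij jN mulf_neq0.
by rewrite lij iN mulf_neq0.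
Qed.

Lemma poly_const_sign (R : rcfType) (s : {poly R}) : (forall y, ~~ root s y) ->
  (forall y, 0 < s.[y]) \/ (forall y, 0 < (- s).[y]).
Proof.
move=> nr; have s0 y : s.[y] != 0 by have := nr y; rewrite rootE.
have same y z : 0 < s.[y] * s.[z].
  wlog lyz : y z / y <= z => [H|].
    by case/orP: (le_total y z) => /H // ; rewrite mulrC.
  rewrite lt_neqAle eq_sym mulf_neq0 //= leNgt; apply/negP => lt0.
  by have [t _ rt] := poly_ivtoo lyz lt0; have := nr t; rewrite rt.
case: (ltgtP 0 s.[0]) (s0 0) => // h _; [left|right] => y.
  by have := same 0 y; rewrite pmulr_rgt0.
by have := same 0 y; rewrite nmulr_rgt0 // hornerN oppr_gt0.
Qed.

(** * Orthogonality and Gauss quadrature for a discrete measure *)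

Definition wsum (R : rcfType) (N : nat) (w x : nat -> R) (f : {poly R}) : R :=
  \sum_(m < N) w m * f.[x m].

Section WeightedSum.
Context (R : rcfType) (N : nat) (w x : nat -> R).
Hypothesis w_gt0 : forall m, (m < N)%N -> 0 < w m.
Hypothesis x_inj : {in [pred m | (m < N)%N] &, injective x}.
Local Notation S := (wsum N w x).

Lemma wsumD (f g : {poly R}) : S (f + g) = S f + S g.
Proof.
by rewrite /wsum -big_split; apply: eq_bigr => m _; rewrite hornerD mulrDr.
Qed.

Lemma wsumZ c (f : {poly R}) : S (c *: f) = c * S f.
Proof.
by rewrite /wsum mulr_sumr; apply: eq_bigr => m _; rewrite hornerZ mulrCA.
Qed.

Lemma wsum0 : S 0 = 0.
Proof. by rewrite /wsum big1 // => m _; rewrite horner0 mulr0. Qed.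

Lemma wsumB (f g : {poly R}) : S (f - g) = S f - S g.
Proof. by rewrite wsumD -scaleN1r wsumZ mulN1r. Qed.

Lemma wsum_sum I r (P : pred I) (F : I -> {poly R}) :
  S (\sum_(i <- r | P i) F i) = \sum_(i <- r | P i) S (F i).
Proof. exact: (big_morph S wsumD wsum0). Qed.

Lemma wsum_ge0 (f : {poly R}) : (forall y, 0 <= f.[y]) -> 0 <= S f.
Proof.
by move=> f0; apply: sumr_ge0 => m _; rewrite mulr_ge0 // ltW // w_gt0.
Qed.

Lemma wsum_eq0 (f : {poly R}) :
  (forall y, 0 <= f.[y]) -> S f = 0 -> forall m, (m < N)%N -> f.[x m] = 0.
Proof.
move=> f0 /eqP; rewrite psumr_eq0 => [/allP Sf m mN|m _]; last first.
  by rewrite mulr_ge0 // ltW // w_gt0.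
have /= := Sf (Ordinal mN) (mem_index_enum _).
by rewrite mulf_eq0 gt_eqF ?w_gt0 //= => /eqP.
Qed.

(** Write [p = q * d] with [d] the product over the distinct real roots. The cofactor [q] has no
    real root, hence a constant sign; if [d] had degree below [n], testing [p] against [d] would
    force [d] to vanish at every node. *)
Lemma wsum_orth_roots n (p : {poly R}) :
  (n < N)%N -> p != 0 -> (size p <= n.+1)%N ->
  (forall r : {poly R}, (size r <= n)%N -> S (p * r) = 0) ->
  size (rootsR p) = n.
Proof.
move=> nN p0 sp orth.
have rsP y : root p y = (y \in rootsR p).
  by have := roots_on_rootsR p0 y; rewrite itv_boundlr /= => <-.
have urs : uniq (rootsR p) by exact: uniq_roots.
have [q pE] : exists q, p = q * \prod_(z <- rootsR p) ('X - z%:P).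
  apply: uniq_roots_prod_XsubC; last by rewrite uniq_rootsE.
  by apply/allP => y; rewrite rsP.
set d := \prod_(z <- _) _ in pE.
have sd : size d = (size (rootsR p)).+1 by exact: size_prod_XsubC.
have d0 : d != 0 by rewrite -size_poly_eq0 sd.
have q0 : q != 0 by apply: contraNneq p0 => q0; rewrite pE q0 mul0r.
have sizep : size p = (size q + size (rootsR p))%N.
  by rewrite {1}pE size_mul // sd addnS.
have q_gt0 : (0 < size q)%N by rewrite size_poly_gt0.
(* A root [y] of [q] is also a root of [d], so [p] is [g = q' * d'] times the square of ['X - y%:P].
   Orthogonality to [g] annihilates the sum of the square of [g * ('X - y%:P)], whose degree is too
   low to vanish at all nodes. *)
have nrq y : ~~ root q y.
  apply/negP => /factor_theorem[q' q'E].
  have : y \in rootsR p by rewrite -rsP pE q'E rootM rootM root_XsubC eqxx orbT.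
  rewrite -root_prod_XsubC => /factor_theorem[d' d'E].
  have {}d'E : d = d' * ('X - y%:P) by [].
  have q'0 : q' != 0 by apply: contraNneq q0 => h; rewrite q'E h mul0r.
  have d'0 : d' != 0 by apply: contraNneq d0 => h; rewrite d'E h mul0r.
  have pE' : p = q' * d' * ('X - y%:P) ^+ 2 by rewrite pE q'E d'E; ring.
  have sr : (size (q' * d')).+2 = size p.
    rewrite pE' (@size_Mmonic _ (q' * d')) ?mulf_neq0 ?monic_exp ?monicXsubC //.
    by rewrite size_exp_XsubC addnC.
  have := orth (q' * d'); rewrite -ltnS (leq_trans _ sp) -?sr // => /(_ isT).
  have -> : p * (q' * d') = (q' * d' * ('X - y%:P)) ^+ 2 by rewrite pE'; ring.
  move/wsum_eq0 => H.
  have : q' * d' * ('X - y%:P) = 0.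
    apply: (poly_eq0_on_nodes x_inj) => [|m mN].
      rewrite (@size_Mmonic _ (q' * d')) ?mulf_neq0 ?monicXsubC //.
      rewrite size_XsubC addn2 /=.
      by rewrite (leq_trans _ nN) // ltnW // sr.
    apply/eqP; rewrite -sqrf_eq0 -horner_exp; apply/eqP/H => // z.
    by rewrite horner_exp sqr_ge0.
  by move/eqP; rewrite !mulf_eq0 polyXsubC_eq0 (negPf q'0) (negPf d'0).
apply/eqP; rewrite eqn_leq; apply/andP; split.
  rewrite -ltnS (leq_trans _ sp) // sizep.
  by rewrite -[X in (X <= _)%N]add1n leq_add2r.
rewrite leqNgt; apply/negP => lt.
have Sd : S (q * d ^+ 2) = 0 by rewrite expr2 mulrA -pE orth // sd.
case: (poly_const_sign nrq) => qs.
  have dE : d = 0.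
    apply: (poly_eq0_on_nodes x_inj) => [|m mN].
      by rewrite sd (leq_trans lt) // ltnW.
    have : (q * d ^+ 2).[x m] = 0.
      apply: wsum_eq0 => // y.
      by rewrite hornerM horner_exp mulr_ge0 ?sqr_ge0 // ltW.
    by move/eqP; rewrite hornerM horner_exp mulf_eq0 gt_eqF //= sqrf_eq0 => /eqP.
  by rewrite dE eqxx in d0.
have dE : d = 0.
  apply: (poly_eq0_on_nodes x_inj) => [|m mN].
      by rewrite sd (leq_trans lt) // ltnW.
  have : (- q * d ^+ 2).[x m] = 0.
    apply: wsum_eq0 => // [y|].
      by rewrite hornerM horner_exp mulr_ge0 ?sqr_ge0 // ltW.
    by rewrite mulNr -scaleN1r wsumZ Sd mulr0.
  by move/eqP; rewrite hornerM horner_exp mulf_eq0 gt_eqF //= sqrf_eq0 => /eqP.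
by rewrite dE eqxx in d0.
Qed.

Lemma gauss_quadrature (z : seq R) : uniq z ->
  (forall r : {poly R}, (size r <= size z)%N ->
     S (\prod_(t <- z) ('X - t%:P) * r) = 0) ->
  exists2 lam : 'I_(size z) -> R, (forall j, 0 <= lam j) &
    forall f : {poly R}, (size f <= (size z).*2)%N ->
      S f = \sum_j lam j * f.[z`_j].
Proof.
move=> uz orth; pose l (j : 'I_(size z)) : {poly R} :=
  \prod_(k < size z | k != j) ('X - (z`_k)%:P).
have lE (j k : 'I_(size z)) : k != j -> (l j).[z`_k] = 0.
  move=> kj; rewrite horner_prod (bigD1 k) //= !hornerE subrr.
  by rewrite mul0r.
have l0 j : (l j).[z`_j] != 0.
  rewrite horner_prod prodf_seq_neq0; apply/allP => k _; apply/implyP => kj.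
  by rewrite !hornerE subr_eq0 nth_uniq // eq_sym.
have sl j : size (l j) = size z by exact: size_prod_XsubC_neq.
pose L j := (l j).[z`_j] ^- 2 *: (l j) ^+ 2.
(* The interpolants are the squares L_j, so that the weights S(L_j) are
   visibly nonnegative; f - sum_j f(z_j) L_j still vanishes at every z_j. *)
exists (S \o L) => [j|f sf] /=.
  apply: wsum_ge0 => y.
  by rewrite hornerZ horner_exp mulr_ge0 ?invr_ge0 ?sqr_ge0.
pose h := f - \sum_(j < size z) f.[z`_j] *: L j.
have [q hE] : exists q, h = q * \prod_(t <- z) ('X - t%:P).
  apply: uniq_roots_prod_XsubC; last by rewrite uniq_rootsE.
  apply/(all_nthP 0) => k kz; rewrite rootE /h hornerD hornerN horner_sum.
  rewrite (bigD1 (Ordinal kz)) //= big1 ?addr0 => [|j jk].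
    by rewrite !hornerZ horner_exp mulVf ?mulr1 ?subrr // expf_neq0 // l0.
  rewrite !hornerZ horner_exp (lE j (Ordinal kz)) 1?eq_sym //.
  by rewrite expr0n !mulr0.
have sh : (size h <= (size z).*2)%N.
  rewrite (leq_trans (size_polyD _ _)) // geq_max sf size_polyN.
  apply: (leq_trans (size_sum _ _ _)); apply/bigmax_leqP => j _.
  do 2 rewrite (leq_trans (size_scale_leq _ _)) //.
  by rewrite expr2 (leq_trans (size_polyMleq _ _)) // sl addnn leq_pred.
(* The quotient [q] is small enough to be a test polynomial, so orthogonality kills the
   interpolation error [h]. *)
have sq : (size q <= size z)%N.
  have [->|q0] := eqVneq q 0; first by rewrite size_poly0.
  move: sh; rewrite hE size_Mmonic ?monic_prod_XsubC // size_prod_XsubC.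
  by rewrite addnS /= -addnn leq_add2r.
have : S h = 0 by rewrite hE mulrC orth.
rewrite /h wsumB => /eqP; rewrite subr_eq0 => /eqP ->.
by rewrite wsum_sum; apply: eq_bigr => j _; rewrite wsumZ mulrC.
Qed.

End WeightedSum.

(** * Chebyshev's sum inequality and Markov's comparison of zeros *)

(** Symmetrising [B * W - A * V] in the two summation indices cancels [z] and leaves terms
    [(w i * v j - w j * v i) * (x j - x i)] times a square, all nonnegative and one positive. But
    [B <= 0 <= A] would give [B * W <= A * V]. *)
Lemma wsum_chebyshev (R : rcfType) N (w v x : nat -> R) (z : R) (r : {poly R}) :
  (forall i j, (i < j < N)%N -> x i < x j) ->
  (forall i j, (i < j < N)%N -> w j * v i < w i * v j) ->
  (forall m, (m < N)%N -> 0 < w m) -> (forall m, (m < N)%N -> 0 < v m) ->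
  (exists i j, (i < j < N)%N && (r.[x i] * r.[x j] != 0)) ->
  0 <= wsum N w x (('X - z%:P) * r ^+ 2) ->
  0 < wsum N v x (('X - z%:P) * r ^+ 2).
Proof.
move=> x_lt wv_lt w_gt0 v_gt0 [i0 [j0 /andP[/andP[ij jN] r0]]].
set A := wsum N w x _; set B := wsum N v x _ => A0.
rewrite ltNge; apply/negP => B0.
pose W := wsum N w x (r ^+ 2); pose V := wsum N v x (r ^+ 2).
have W0 : 0 <= W by apply: wsum_ge0 => // y; rewrite horner_exp sqr_ge0.
have V0 : 0 <= V by apply: wsum_ge0 => // y; rewrite horner_exp sqr_ge0.
pose F (i j : nat) : R :=
  (w j * v i - w i * v j) * (x i - z) * (r.[x i] * r.[x j]) ^+ 2.
have DE : B * W - A * V = \sum_(i < N) \sum_(j < N) F i j.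
  rewrite /A /B /W /V /wsum !mulr_suml -sumrB; apply: eq_bigr => i _.
  rewrite !mulr_sumr -sumrB; apply: eq_bigr => j _.
  by rewrite /F !hornerE /=; ring.
have D2E : (B * W - A * V) *+ 2 = \sum_(i < N) \sum_(j < N) (F i j + F j i).
  rewrite mulr2n {2}DE exchange_big DE -big_split /=; apply: eq_bigr => i _.
  by rewrite -big_split.
have F_ge0 i j : (i < N)%N -> (j < N)%N -> 0 <= F i j + F j i.
  move=> iN jN'; wlog lij : i j iN jN' / (i <= j)%N.
    by move=> H; case/orP: (leq_total i j) => /H; [|rewrite addrC]; apply.
  move: lij; rewrite leq_eqVlt => /predU1P[->|lij].
    by rewrite /F subrr !mul0r addr0.
  have -> : F i j + F j i = (w i * v j - w j * v i) * (x j - x i) *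
     (r.[x i] * r.[x j]) ^+ 2 by rewrite /F; ring.
  by rewrite mulr_ge0 ?sqr_ge0 // mulr_ge0 // subr_ge0 ltW // ?x_lt ?wv_lt ?lij.
have F_gt0 : 0 < F i0 j0 + F j0 i0.
  have -> : F i0 j0 + F j0 i0 = (w i0 * v j0 - w j0 * v i0) * (x j0 - x i0) *
     (r.[x i0] * r.[x j0]) ^+ 2 by rewrite /F; ring.
  by rewrite mulr_gt0 ?exprn_even_gt0 // mulr_gt0 // subr_gt0 ?x_lt ?wv_lt ?ij.
have iN := ltn_trans ij jN.
have : 0 < (B * W - A * V) *+ 2.
  rewrite D2E (bigD1 (Ordinal iN)) //= ltr_wpDr //.
    by apply: sumr_ge0 => i _; apply: sumr_ge0 => j _; apply: F_ge0.
  rewrite (bigD1 (Ordinal jN)) //= ltr_wpDr //.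
  by apply: sumr_ge0 => j _; apply: F_ge0.
rewrite pmulrn_lgt0 // ltNge subr_le0 => /negP; apply.
by rewrite (@le_trans _ _ 0) ?mulr_ge0 // mulr_le0_ge0.
Qed.

(** Having [n] distinct real roots, [p] is a scalar multiple of the monic product, which is the form
    that [gauss_quadrature] expects. *)
Lemma wsum_orth_prod (R : rcfType) N n (w x : nat -> R) (p : {poly R}) :
  (forall m, (m < N)%N -> 0 < w m) ->
  {in [pred m | (m < N)%N] &, injective x} ->
  (n < N)%N -> p != 0 -> (size p <= n.+1)%N ->
  (forall r : {poly R}, (size r <= n)%N -> wsum N w x (p * r) = 0) ->
  forall r : {poly R}, (size r <= n)%N ->
    wsum N w x (\prod_(t <- rootsR p) ('X - t%:P) * r) = 0.
Proof.
move=> w_gt0 x_inj nN p0 sp orth r sr.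
have srs := wsum_orth_roots w_gt0 x_inj nN p0 sp orth.
have rsp : all (root p) (rootsR p).
  apply/allP => y; rewrite -(roots_on_rootsR p0).
  by case/andP.
have urs : uniq (rootsR p) by exact: uniq_roots.
have sp' : size p = (size (rootsR p)).+1.
  by apply/eqP; rewrite eqn_leq {1}srs sp max_poly_roots.
have := orth r sr; rewrite {1}(all_roots_prod_XsubC sp' rsp); last first.
  by rewrite uniq_rootsE.
rewrite -scalerAl wsumZ => /eqP; rewrite mulf_eq0 lead_coef_eq0 (negPf p0).
by move/eqP.
Qed.

Lemma markov_comparison (R : rcfType) N n (w v x : nat -> R) (p q : {poly R}) :
  (forall i j, (i < j < N)%N -> x i < x j) ->
  (forall i j, (i < j < N)%N -> w j * v i < w i * v j) ->
  (forall m, (m < N)%N -> 0 < w m) -> (forall m, (m < N)%N -> 0 < v m) ->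
  (n < N)%N ->
  p != 0 -> (size p <= n.+1)%N ->
  (forall r : {poly R}, (size r <= n)%N -> wsum N w x (p * r) = 0) ->
  q != 0 -> (size q <= n.+1)%N ->
  (forall r : {poly R}, (size r <= n)%N -> wsum N v x (q * r) = 0) ->
  forall i : 'I_n, (rootsR p)`_i < (rootsR q)`_i.
Proof.
move=> x_lt wv_lt w_gt0 v_gt0 nN p0 sp op q0 sq oq i.
have x_inj : {in [pred m | (m < N)%N] &, injective x}.
  move=> k l; rewrite !inE => kN lN xkl.
  by case: (ltngtP k l) => // kl; [have := x_lt k l|have := x_lt l k];
    rewrite kl ?kN ?lN xkl ltxx => /(_ isT).
have sz := wsum_orth_roots w_gt0 x_inj nN p0 sp op.
have sy := wsum_orth_roots v_gt0 x_inj nN q0 sq oq.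
have oz := wsum_orth_prod w_gt0 x_inj nN p0 sp op.
have oy := wsum_orth_prod v_gt0 x_inj nN q0 sq oq.
have : sorted <%R (rootsR p) by exact: sorted_roots.
have : sorted <%R (rootsR q) by exact: sorted_roots.
move: (rootsR p) (rootsR q) sz sy oz oy => z y sz sy oz oy sorty sortz.
rewrite ltNge; apply/negP => yz.
pose r : {poly R} :=
  \prod_(j < n | j != i) ('X - (if (j < i)%N then z`_j else y`_j)%:P).
have sr : size r = n by exact: size_prod_XsubC_neq.
(* The degree is at most [2n - 1], within the exactness of both quadratures. *)
have srX (c : R) : (size (('X - c%:P) * r ^+ 2)%R <= n.*2)%N.
  rewrite mulrC size_Mmonic ?monicXsubC //; last first.
    rewrite expf_neq0 // -size_poly_eq0 sr -lt0n.
    exact: leq_ltn_trans (ltn_ord i).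
  rewrite size_XsubC addn2 /= -addnn expr2.
  rewrite (leq_ltn_trans (size_polyMleq r r)) //.
  by rewrite sr ltn_predL addn_gt0 (leq_ltn_trans _ (ltn_ord i)).
have rz (j : 'I_n) : (j < i)%N -> r.[z`_j] = 0.
  move=> ji; rewrite horner_prod (bigD1 j) /=; last by rewrite neq_ltn ji.
  by rewrite ji hornerXsubC subrr mul0r.
have ry (j : 'I_n) : (i < j)%N -> r.[y`_j] = 0.
  move=> ij; rewrite horner_prod (bigD1 j) /=; last by rewrite neq_ltn ij orbT.
  by rewrite ltnNge ltnW //= hornerXsubC subrr mul0r.
have Sz : 0 <= wsum N w x (('X - (z`_i)%:P) * r ^+ 2).
  have [||lam lam0 ->] := @gauss_quadrature R N w x w_gt0 z.
  - exact: lt_sorted_uniq.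
  - by rewrite sz.
  - apply: sumr_ge0 => j _; rewrite mulr_ge0 // hornerM horner_exp hornerXsubC.
    have jn : (j < n)%N by rewrite -sz.
    (* The terms with [j < i] vanish with [r]; in the others [z_j - z_i] is nonnegative because the
       zeros are sorted. The sum at the [y_j] is treated symmetrically. *)
    have [ji|ij] := ltnP j i.
      by rewrite (rz (Ordinal jn)) // expr0n mulr0.
    by rewrite mulr_ge0 ?sqr_ge0 // subr_ge0 (lt_sorted_leq_nth) ?inE ?sz.
  - by rewrite sz.
have Sy : wsum N v x (('X - (y`_i)%:P) * r ^+ 2) <= 0.
  have [||lam lam0 ->] := @gauss_quadrature R N v x v_gt0 y.
  - exact: lt_sorted_uniq.
  - by rewrite sy.
  - apply: sumr_le0 => j _.
    rewrite mulr_ge0_le0 // hornerM horner_exp hornerXsubC.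
    have jn : (j < n)%N by rewrite -sy.
    have [ij|ji] := ltnP i j.
      by rewrite (ry (Ordinal jn)) // expr0n mulr0.
    by rewrite mulr_le0_ge0 ?sqr_ge0 // subr_le0 (lt_sorted_leq_nth) ?inE ?sy.
  - by rewrite sy.
have : 0 < wsum N v x (('X - (z`_i)%:P) * r ^+ 2).
  apply: (wsum_chebyshev x_lt wv_lt) => //; apply: poly_two_nodes => //.
    by rewrite -size_poly_eq0 sr -lt0n (leq_ltn_trans _ (ltn_ord i)).
  by rewrite sr.
(* Under [y_i <= z_i], replacing [z_i] by [y_i] can only increase the sum, which [Sy] bounds by
   0. *)
rewrite ltNge => /negP; apply; apply: le_trans Sy.
apply: ler_sum => m _; rewrite ler_pM2l ?v_gt0 // !(hornerM, hornerXsubC).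
by rewrite ler_wpM2r ?lerD2l ?lerN2 // -expr2 sqr_ge0.
Qed.

(** * Tools for proving orthogonality *)

(** The products form a Newton basis, one monic polynomial per degree, so the leading term of [r]
    can be stripped off inductively. The points [c] are free, to be chosen so that the moments have
    closed forms. *)
Lemma wsum_orth_span (R : rcfType) N n (w x c : nat -> R) (p : {poly R}) :
  (forall l, (l < n)%N -> wsum N w x (p * \prod_(j < l) ('X - (c j)%:P)) = 0) ->
  forall r : {poly R}, (size r <= n)%N -> wsum N w x (p * r) = 0.
Proof.
elim: n => [|n IHn] orth r sr.
  by move: sr; rewrite leqn0 size_poly_eq0 => /eqP ->; rewrite mulr0 wsum0.
pose b : {poly R} := \prod_(j < n) ('X - (c j)%:P).
have sb : size b = n.+1.
  by rewrite size_prod_XsubC -[RHS]/(n.+1) -[in RHS](card_ord n) cardE enumT.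
have bn : b`_n = 1.
  by have /monicP := monic_prod_XsubC (index_enum 'I_n) predT (c \o val);
    rewrite lead_coefE -/b sb.
rewrite -(subrK (r`_n *: b) r) mulrDr wsumD -scalerAr wsumZ orth // mulr0 addr0.
apply: IHn => [l ln|]; first by apply: orth; apply: ltnW.
apply/leq_sizeP => j; rewrite leq_eqVlt => /predU1P[<-|nj].
  by rewrite coefB coefZ bn mulr1 subrr.
rewrite coefB coefZ [r`_j]nth_default; last exact: leq_trans sr nj.
by rewrite [b`_j]nth_default ?sb // mulr0 subrr.
Qed.

(** This is an [n]-th finite difference of a polynomial in [k] of degree [l < n]. The bound [n <= M]
    keeps [M - k] from truncating. *)
Lemma finite_difference_ffact (R : comNzRingType) n M l : (l < n <= M)%N ->
  \sum_(k < n.+1) (-1) ^+ k * ('C(n, k) * (M - k) ^_ l)%:R = 0 :> R.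
Proof.
pose T n (f : nat -> R) : R := \sum_(k < n.+1) (-1) ^+ k * 'C(n, k)%:R * f k.
(* Pascal's rule: one order of the alternating sum is traded for one difference of [f]. *)
have TS m f : T m.+1 f = T m (fun k => f k - f k.+1).
  rewrite /T big_ord_recl /= bin0.
  under eq_bigr => k _ do rewrite /bump /= add1n binS natrD mulrDr mulrDl.
  rewrite big_split /= addrA.
  under [RHS]eq_bigr => k _ do rewrite mulrBr.
  rewrite sumrB; congr (_ + _); last first.
    by rewrite -sumrN; apply: eq_bigr => k _; rewrite exprS !mulN1r !mulNr.
  rewrite [RHS]big_ord_recl /= bin0; congr (_ + _).
  by rewrite big_ord_recr /= bin_small // mulr0 mul0r addr0.
suff H : (l < n <= M)%N -> T n (fun k => ((M - k) ^_ l)%:R) = 0.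
  move=> lnM; rewrite -[RHS](H lnM); apply: eq_bigr => k _.
  by rewrite natrM mulrA.
elim: n M l => // n IHn [|M] [|l]; rewrite ?andbF // TS => lnM.
  by rewrite /T big1 // => k _; rewrite !ffactn0 subrr mulr0.
rewrite -[RHS](mulr0 (l.+1)%:R) -(IHn M l) // /T mulr_sumr.
apply: eq_bigr => k _; rewrite subSS subSn; last first.
  by rewrite (leq_trans (ltnSE (ltn_ord k))) //; case/andP: lnM.
have -> : (M - k).+1 ^_ l.+1 = ((M - k) ^_ l.+1 + l.+1 * (M - k) ^_ l)%N.
  rewrite ffactSS ffactnSr; have [lk|kl] := leqP l (M - k).
    by rewrite [(l.+1 * _)%N]mulnC -mulnDr addnS subnK // mulnC.
  by rewrite ffact_small // !muln0.
by rewrite natrD natrM; ring.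
Qed.

Lemma pochE (R : realType) (u : R) k : poch u k = \prod_(j < k) (u + j%:R).
Proof.
rewrite /poch big_add1 big_mkord; apply: eq_bigr => j _.
by rewrite -natr1 addrA addrK.
Qed.

Lemma poch_opp_nat (R : realType) n k : (k <= n)%N ->
  poch (- n%:R : R) k = (-1) ^+ k * (n ^_ k)%:R.
Proof.
elim: k => [|k IHk] kn; first by rewrite pochE big_ord0 mulr1.
have := IHk (ltnW kn); rewrite !pochE big_ord_recr /= => ->.
by rewrite ffactnSr natrM natrB ?(ltnW kn) // exprS; ring.
Qed.

(** * The dual Hahn weight and its dependence on the parameter *)

Section DualHahnWeight.
Context (R : realType) (a : R) (M : nat).
Hypothesis a_gt : - 2^-1 < a.

Definition node (m : nat) : R := xlattice (a + m%:R).

Lemma nodeB i j :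
  node i - node j = (i%:R - j%:R) * (2 * a + 1 + i%:R + j%:R).
Proof. by rewrite /node /xlattice; ring. Qed.

Lemma node_lt i j : (i < j)%N -> node i < node j.
Proof.
move=> ij; rewrite -subr_gt0 nodeB mulr_gt0 // ?subr_gt0 ?ltr_nat //.
have i0 : 0 <= i%:R :> R by []; have j0 : 0 <= j%:R :> R by [].
by move: a_gt => ?; lra.
Qed.

(** The weight takes [l = M - k]; the indices are kept independent because the moments below involve
    general pairs. *)
Definition hahn_num (alpha : R) (k l : nat) : R :=
  (\prod_(j < k) (alpha + 1 + j%:R)) *
  \prod_(j < l) (2 * a + M%:R - alpha - j%:R).

(** For [m <= M], the absolute value at [node m] of the derivative of the monic polynomial vanishing
    at the nodes [0] to [M], with lower and upper nodes separated so that each factor is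
    positive. *)
Definition node_gap (m : nat) : R :=
  (\prod_(j < m) (node m - node j)) *
  \prod_(j < M - m) (node (M - j) - node m).

(* Up to a factor independent of [m], the classical dual Hahn weight
   (2s+1) Gamma(a+s+1) Gamma(c+s+1)
   / (Gamma(s-a+1) Gamma(a+N-s) Gamma(a+N+s+1) Gamma(s-c+1))
   at s = a + m, with c = alpha - a and N = M + 1. *)
Definition hahn_weight (alpha : R) (m : nat) : R :=
  hahn_num alpha m (M - m) / node_gap m.

Lemma node_gap_gt0 m : 0 < node_gap m.
Proof.
by rewrite mulr_gt0 ?prodr_gt0 // => j _; rewrite subr_gt0 node_lt //;
  have := ltn_ord j; lia.
Qed.

Lemma hahn_num_gt0 (alpha : R) m : (m <= M)%N ->
  -1 < alpha < 2 * a + 1 -> 0 < hahn_num alpha m (M - m).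
Proof.
move=> mM /andP[al1 al2]; rewrite mulr_gt0 ?prodr_gt0 // => j _.
  by rewrite ltr_wpDr // -ltrBlDr sub0r.
(* As [j + 1 <= M], each factor is at least [2 * a + 1 - alpha]; this is where the upper bound on
   [alpha] enters. *)
have : (j.+1)%:R <= M%:R :> R by rewrite ler_nat; have := ltn_ord j; lia.
by rewrite -natr1; lra.
Qed.

Lemma hahn_weight_gt0 (alpha : R) m : (m <= M)%N ->
  -1 < alpha < 2 * a + 1 -> 0 < hahn_weight alpha m.
Proof. by move=> mM al; rewrite divr_gt0 ?node_gap_gt0 ?hahn_num_gt0. Qed.

Lemma hahn_num_step (alpha : R) m : (m < M)%N ->
  hahn_num alpha m.+1 (M - m.+1) * (2 * a + 1 - alpha + m%:R) =
  hahn_num alpha m (M - m) * (alpha + 1 + m%:R).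
Proof.
move=> mM; rewrite /hahn_num big_ord_recr /= -(subnSK mM) big_ord_recr /=.
by rewrite natrB // -natr1; ring.
Qed.

(** The node gaps do not depend on the parameter and cancel. By [hahn_num_step], consecutive
    numerators have ratio [(alpha + 1 + m) / (2 * a + 1 - alpha + m)], increasing in [alpha];
    induction on [j] chains these comparisons. *)
Lemma hahn_weight_ratio (alpha beta : R) i j :
  -1 < alpha -> alpha < beta -> beta < 2 * a + 1 -> (i < j <= M)%N ->
  hahn_weight alpha j * hahn_weight beta i <
  hahn_weight alpha i * hahn_weight beta j.
Proof.
move=> al ab be /andP[ij jM].
have al' : -1 < alpha < 2 * a + 1 by rewrite al (lt_trans ab).
have be' : -1 < beta < 2 * a + 1 by rewrite be (lt_trans al).
rewrite /hahn_weight !mulf_div [node_gap j * _]mulrC.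
rewrite ltr_pM2r; last first.
  by rewrite invr_gt0; apply: mulr_gt0; apply: node_gap_gt0.
pose u m := hahn_num alpha m (M - m); pose v m := hahn_num beta m (M - m).
have u0 m : (m <= M)%N -> 0 < u m by move=> ?; apply: hahn_num_gt0.
have v0 m : (m <= M)%N -> 0 < v m by move=> ?; apply: hahn_num_gt0.
rewrite -/(u i) -/(u j) -/(v i) -/(v j).
have step m : (m < M)%N -> u m.+1 * v m < u m * v m.+1.
  move=> mM; have m0 : 0 <= m%:R :> R by [].
  pose s : R := (2 * a + 1 - alpha + m%:R) * (2 * a + 1 - beta + m%:R).
  have s0 : 0 < s by rewrite mulr_gt0 //; lra.
  rewrite -(ltr_pM2r s0).
  have -> : u m.+1 * v m * s =
      u m * v m * ((alpha + 1 + m%:R) * (2 * a + 1 - beta + m%:R)).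
    transitivity (u m.+1 * (2 * a + 1 - alpha + m%:R) *
                  (v m * (2 * a + 1 - beta + m%:R))); first by rewrite /s; ring.
    by rewrite /u hahn_num_step //; ring.
  have -> : u m * v m.+1 * s =
      u m * v m * ((beta + 1 + m%:R) * (2 * a + 1 - alpha + m%:R)).
    transitivity (v m.+1 * (2 * a + 1 - beta + m%:R) *
                  (u m * (2 * a + 1 - alpha + m%:R))); first by rewrite /s; ring.
    by rewrite /v hahn_num_step //; ring.
  rewrite ltr_pM2l; last by rewrite mulr_gt0 ?u0 ?v0 // ltnW.
  by rewrite ltr_pM //; lra.
elim: j ij jM => // j IHj; rewrite ltnS leq_eqVlt => /predU1P[->|ij] jM.
  exact: step.
have := IHj ij (ltnW jM); have := step j jM => h1 h2.
rewrite -(ltr_pM2l (v0 j (ltnW jM))).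
apply: (@lt_trans _ _ (u j * v j.+1 * v i)).
  by rewrite mulrCA mulrA ltr_pM2r // v0 // (leq_trans (ltnW ij)) // ltnW.
by rewrite mulrAC [ltRHS]mulrA [v j * _]mulrC ltr_pM2r ?v0.
Qed.

(** * Moments and orthogonality of the dual Hahn polynomials *)

Local Notation phi k := (\prod_(j < k) ((node j)%:P - 'X)).
Local Notation psi l := (\prod_(j < l) ('X - (node (M - j))%:P)).

Lemma phi_horner_eq0 k m : (m < k)%N -> (phi k).[node m] = 0.
Proof.
by move=> mk; rewrite horner_prod (bigD1 (Ordinal mk)) //= !hornerE subrr mul0r.
Qed.

Lemma psi_horner_eq0 l m : (m <= M)%N -> (M - m < l)%N -> (psi l).[node m] = 0.
Proof.
move=> mM ml; rewrite horner_prod (bigD1 (Ordinal ml)) //= hornerXsubC subKn //.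
by rewrite subrr mul0r.
Qed.

Lemma phi_psi_horner k l : (k + l)%N = M ->
  (phi k).[node k] * (psi l).[node k] = (-1) ^+ M * node_gap k.
Proof.
move=> klM; rewrite /node_gap -klM addKn !horner_prod exprD mulrACA.
congr (_ * _).
  under eq_bigr => j _ do rewrite hornerD hornerN hornerC hornerX -opprB.
  by rewrite prodrN card_ord.
under eq_bigr => j _ do rewrite hornerXsubC -opprB.
by rewrite prodrN card_ord.
Qed.

(* Since psi_(l+1) phi_k + psi_l phi_(k+1) = (x_k - x_(M-l)) phi_k psi_l, the
   moments reduce to the case k + l = M, where phi_k psi_l vanishes at every
   node but the k-th. *)
Lemma hahn_moment_aux alpha d k l : (k + l + d)%N = M ->
  wsum M.+1 (hahn_weight alpha) node (phi k * psi l) =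
  (-1) ^+ (k + l) * hahn_num alpha k l / d`!%:R.
Proof.
elim: d k l => [|d IHd] k l klM.
  have kM : (k < M.+1)%N by lia.
  rewrite /wsum (bigD1 (Ordinal kM)) //= [X in _ + X]big1 ?addr0 => [|m mk].
    rewrite addn0 in klM; rewrite hornerM (phi_psi_horner klM) klM fact0 divr1.
    rewrite /hahn_weight (_ : M - k = l)%N; last by rewrite -klM addKn.
    by rewrite mulrCA divfK // gt_eqF // node_gap_gt0.
  rewrite hornerM; case: (ltngtP m k) => mk'.
  - by rewrite phi_horner_eq0 // mul0r mulr0.
  - by rewrite (@psi_horner_eq0 l m) ?mulr0 //; have := ltn_ord m; lia.
  - by case/eqP: mk; apply: val_inj.
have nz : node k - node (M - l) != 0.
  by rewrite subr_eq0 lt_eqF // node_lt //; lia.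
apply: (mulfI nz).
have -> : (node k - node (M - l)) *
    wsum M.+1 (hahn_weight alpha) node (phi k * psi l) =
    wsum M.+1 (hahn_weight alpha) node (phi k.+1 * psi l) +
    wsum M.+1 (hahn_weight alpha) node (phi k * psi l.+1).
  rewrite -wsumZ -wsumD; congr (wsum _ _ _ _).
  rewrite !big_ord_recr /= -mul_polyC polyCB; ring.
rewrite !IHd; try lia.
have d0 : d.+1%:R != 0 :> R by rewrite pnatr_eq0.
have d1 : d`!%:R != 0 :> R by rewrite pnatr_eq0 -lt0n fact_gt0.
rewrite nodeB /hahn_num !big_ord_recr /= factS natrM addSn addnS !exprS.
rewrite -klM natrB; last by lia.
rewrite !natrD -!natr1; field.
by rewrite d1 natr1 d0.
Qed.

(** Rewriting [1 / (M - k - l)!] with a falling factorial includes the case [k + l > M], where both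
    sides vanish, and prepares the finite difference in [k]. *)
Lemma hahn_moment alpha k l : (k <= M)%N ->
  wsum M.+1 (hahn_weight alpha) node (phi k * psi l) =
  (-1) ^+ (k + l) * hahn_num alpha k l * ((M - k) ^_ l)%:R / (M - k)`!%:R.
Proof.
move=> kM; have [klM|Mkl] := leqP (k + l) M.
  rewrite (@hahn_moment_aux alpha (M - k - l)); last by lia.
  have lMk : (l <= M - k)%N by lia.
  rewrite -(ffact_fact lMk) natrM.
  have := fact_gt0 (M - k - l); rewrite lt0n -(@pnatr_eq0 R) => h1.
  have : ((M - k) ^_ l != 0)%N by rewrite -lt0n ffact_gt0.
  by rewrite -(@pnatr_eq0 R) => h2; field; apply/andP.
rewrite ffact_small; last by lia.
rewrite mulr0 mul0r /wsum big1 // => m _; rewrite hornerM.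
have [mk|km] := ltnP m k; first by rewrite phi_horner_eq0 // mul0r mulr0.
by rewrite (@psi_horner_eq0 l m) ?mulr0 //; have := ltn_ord m; lia.
Qed.

(** Test against [psi l] with [l < n]. In the [k]-th term the moment cancels [(alpha + 1)_k],
    nonzero since [alpha > -1], and [(1 - N)_k] merges with [(M - k)!] into [M!] up to sign. What
    remains is the [n]-th difference of [(M - k) ^_ l]. *)
Lemma dual_hahn_orth (alpha : R) n : (n <= M)%N -> -1 < alpha ->
  forall r : {poly R}, (size r <= n)%N ->
  wsum M.+1 (hahn_weight alpha) node (dual_hahn M.+1 a n alpha * r) = 0.
Proof.
move=> nM al; apply: (wsum_orth_span (c := fun j => node (M - j))) => l ln.
rewrite /dual_hahn mulr_suml wsum_sum.
transitivity ((-1) ^+ l *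
  (\prod_(j < l) (2 * a + M%:R - alpha - j%:R)) / M`!%:R *
  \sum_(k < n.+1) (-1) ^+ k * ('C(n, k) * (M - k) ^_ l)%:R).
  rewrite mulr_sumr; apply: eq_bigr => k _.
  have kn : (k <= n)%N by rewrite -ltnS.
  have kM := leq_trans kn nM.
  rewrite -scalerAl wsumZ hahn_moment // poch_opp_nat //.
  rewrite (_ : 1 - M.+1%:R = - M%:R); last by rewrite -natr1; ring.
  rewrite poch_opp_nat // -(ffact_fact kM) -bin_ffact.
  rewrite pochE /hahn_num exprD !natrM.
  set P := \prod_(j < k) _; set Q := \prod_(j < l) _.
  have P0 : P != 0.
    apply/prodf_neq0 => j _; rewrite gt_eqF // ltr_wpDr // -ltrBlDr sub0r //.
  have f1 : (M ^_ k)%:R != 0 :> R by rewrite pnatr_eq0 -lt0n ffact_gt0.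
  have f2 m : m`!%:R != 0 :> R by rewrite pnatr_eq0 -lt0n fact_gt0.
  have s0 : (-1) ^+ k != 0 :> R by rewrite expf_neq0 // oppr_eq0 oner_eq0.
  field.
  by rewrite P0 f1 !f2 s0.
by rewrite finite_difference_ffact ?ln // mulr0.
Qed.

(** At [node 0] only the term [k = 0] survives, and it equals 1. *)
Lemma dual_hahn_neq0 (alpha : R) n : dual_hahn M.+1 a n alpha != 0.
Proof.
apply/eqP => /(congr1 (horner^~ (node 0))); rewrite horner0 horner_sum.
rewrite big_ord_recl [X in _ + X]big1 ?addr0 => [|k _]; last first.
  by rewrite hornerZ phi_horner_eq0 // mulr0.
rewrite hornerZ big_ord0 hornerC !pochE !big_ord0 fact0 !(mulr1, mul1r) invr1.
by move/eqP; rewrite oner_eq0.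
Qed.

Lemma size_dual_hahn (alpha : R) n :
  (size (dual_hahn M.+1 a n alpha) <= n.+1)%N.
Proof.
apply: (leq_trans (size_sum _ _ _)); apply/bigmax_leqP => k _.
apply: (leq_trans (size_scale_leq _ _)).
apply: (@leq_trans k.+1); last exact: ltn_ord.
elim: (k : nat) => [|m IHm]; first by rewrite big_ord0 size_poly1.
rewrite big_ord_recr /= (leq_trans (size_polyMleq _ _)) //.
by rewrite -opprB size_polyN size_XsubC addn2.
Qed.

(** * Monotonicity of the zeros *)

Lemma dual_hahn_zero_lt n (i : 'I_n) (alpha beta : R) : (n <= M)%N ->
  -1 < alpha -> alpha < beta -> beta < 2 * a + 1 ->
  dual_hahn_zero M.+1 a n i alpha < dual_hahn_zero M.+1 a n i beta.
Proof.
move=> nM al ab be.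
have al' : -1 < alpha < 2 * a + 1 by rewrite al (lt_trans ab).
have be' : -1 < beta < 2 * a + 1 by rewrite be (lt_trans al).
apply: (@markov_comparison R M.+1 n
  (hahn_weight alpha) (hahn_weight beta) node).
- by move=> j k /andP[jk _]; apply: node_lt.
- by move=> j k; rewrite ltnS; apply: hahn_weight_ratio.
- by move=> m mM; apply: hahn_weight_gt0.
- by move=> m mM; apply: hahn_weight_gt0.
- by [].
- exact: dual_hahn_neq0.
- exact: size_dual_hahn.
- exact: dual_hahn_orth.
- exact: dual_hahn_neq0.
- exact: size_dual_hahn.
- by apply: dual_hahn_orth => //; apply: lt_trans ab.
Qed.

End DualHahnWeight.

Theorem proposition3p6 (R : realType) (N n : nat) (a : R)
    (hn : (1 <= n <= N - 1)%N) (ha : - 2^-1 < a) :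
  (0 <= a ->
   forall i : 'I_n,
     {in `]-1, 2 * a + 1[ &,
        {homo dual_hahn_zero N a n i : alpha beta / alpha < beta}}) /\
  (a < 0 ->
   forall i : 'I_n,
     {in `]a, 2 * a + 1[ &,
        {homo dual_hahn_zero N a n i : alpha beta / alpha < beta}}).
Proof.
case: N hn => [|M] hn.
  (* For [N = 0] the truncated [N - 1] is 0, which contradicts [1 <= n]. *)
  by move: hn; rewrite sub0n leqn0; case: n => // -[].
have nM : (n <= M)%N by case/andP: hn => _; rewrite subn1.
split=> a0 i alpha beta; rewrite !in_itv /= => /andP[al _] /andP[_ be] ab.
  exact: dual_hahn_zero_lt.
(* Here [-1 < a < alpha], the first inequality because [a > -1/2]. *)
by apply: dual_hahn_zero_lt => //; lra.
Qed.
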